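(* Let $G=(U\cup W,E)$, $U\cap W=\emptyset$, be a connected bipartite irreducible graph with parts $U$ and $W$, and suppose that $G_1=(U,E_1)$ is a graph with vertex-set $U$ which is a faithful representation of $G$. Let $S(U)=\{f\in \mathrm{Aut}(G) \mid f(U)=U\}$. If $\mathrm{Aut}(G)=S(U)$, then $\mathrm{Aut}(G)\cong \mathrm{Aut}(G_1)$.
   Context: All graphs are undirected, simple and finite. $N(v)$ denotes the set of neighbors of a vertex $v$. A graph is irreducible if $N(x)\neq N(y)$ for every pair of distinct vertices $x,y$. $\mathrm{Aut}(X)$ is the automorphism group of the graph $X$. Faithful representation: let $G=(U\cup W,E)$, $U\cap W=\emptyset$, be a bipartite graph with parts $U,W$. A graph $G_1=(U,E_1)$ with vertex-set $U$ is called a faithful representation of $G$ if (i) every automorphism $f$ of $G_1$ extends uniquely to an automorphism of $G$, i.e. there is a unique $e_f\in\mathrm{Aut}(G)$ with $e_f|_U=f$; and (ii) whenever $f\in\mathrm{Aut}(G)$ satisfies $f(U)=U$, the restriction $f|_U$ is an automorphism of $G_1$. *)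

(* Defs.v *)
From HB Require Import structures.
From mathcomp Require Import all_boot all_fingroup.

Set Implicit Arguments.
Unset Strict Implicit.
Unset Printing Implicit Defensive.

Local Open Scope group_scope.

Record sgraph (V : finType) := SGraph {
  adj :> rel V;
  adj_sym : symmetric adj;
  adj_irrefl : irreflexive adj
}.

Definition nbhd (V : finType) (G : sgraph V) (v : V) : {set V} :=
  [set w | G v w].

Definition irreducible (V : finType) (G : sgraph V) : Prop :=
  forall x y : V, x <> y -> nbhd G x <> nbhd G y.

Definition connected (V : finType) (G : sgraph V) : Prop :=
  forall x y : V, connect G x y.

Definition bipartite (V : finType) (G : sgraph V) (U W : {set V}) : Prop :=
  [/\ U :|: W = [set: V], U :&: W = set0
    & forall x y : V, G x y -> (x \in U /\ y \in W) \/ (x \in W /\ y \in U)].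

Definition graph_aut (V : finType) (G : sgraph V) : {set {perm V}} :=
  [set g : {perm V} | [forall x, forall y, G (g x) (g y) == G x y]].

Lemma graph_autP (V : finType) (G : sgraph V) (g : {perm V}) :
  reflect (forall x y, G (g x) (g y) = G x y) (g \in graph_aut G).
Proof.
rewrite inE; apply: (iffP forallP) => [gG x y | gG x].
  by have /forallP/(_ y)/eqP := gG x.
by apply/forallP=> y; rewrite gG.
Qed.

Lemma graph_aut_group_set (V : finType) (G : sgraph V) :
  group_set (graph_aut G).
Proof.
apply/group_setP; split; first by apply/graph_autP=> x y; rewrite !perm1.
move=> g h /graph_autP gG /graph_autP hG.
by apply/graph_autP=> x y; rewrite !permM hG gG.
Qed.

Canonical graph_aut_group (V : finType) (G : sgraph V) : {group {perm V}} :=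
  Group (graph_aut_group_set G).

Definition aut_stab (V : finType) (G : sgraph V) (U : {set V}) :
    {set {perm V}} :=
  [set g in graph_aut G | g @: U == U].

Definition vset (V : finType) (U : {set V}) : finType := {x : V | x \in U}.

Fact restr_subproof (V : finType) (U : {set V}) (g : {perm V})
    (gU : g @: U = U) (u : vset U) : g (val u) \in U.
Proof. by have := imset_f g (valP u); rewrite gU. Qed.

Definition restr_fun (V : finType) (U : {set V}) (g : {perm V})
    (gU : g @: U = U) (u : vset U) : vset U :=
  Sub (g (val u)) (restr_subproof gU u).

Fact restr_fun_inj (V : finType) (U : {set V}) (g : {perm V})
    (gU : g @: U = U) : injective (restr_fun gU).
Proof. by move=> u v /(congr1 val) /= /perm_inj /val_inj. Qed.

Definition restr (V : finType) (U : {set V}) (g : {perm V})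
    (gU : g @: U = U) : {perm vset U} := perm (@restr_fun_inj V U g gU).

Definition extends (V : finType) (U : {set V})
    (g : {perm V}) (f : {perm vset U}) : Prop :=
  forall u : vset U, g (val u) = val (f u).

Definition faithful_representation (V : finType) (G : sgraph V) (U : {set V})
    (G1 : sgraph (vset U)) : Prop :=
  (forall f : {perm vset U}, f \in graph_aut G1 ->
     exists! g : {perm V}, g \in graph_aut G /\ extends g f)
  /\ (forall (g : {perm V}) (gU : g @: U = U), g \in graph_aut G ->
     restr gU \in graph_aut G1).

(* Main.v *)
Require Import Defs.
From HB Require Import structures.
From mathcomp Require Import all_boot all_fingroup.

Local Open Scope group_scope.

(** Since every automorphism of [G] preserves [U], restriction to [U] is a homomorphism into the
    automorphisms of [G1], by clause (ii) of faithfulness ([restr_perm_vsetM],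
    [restr_perm_vset_aut]). Its fibre over [f] consists of the extensions of [f], and clause (i)
    says there is exactly one. *)

(* Junk value 1 when [g] does not preserve [U]. *)
Definition restr_perm_vset (V : finType) (U : {set V}) (g : {perm V}) :
    {perm vset U} :=
  if @eqP _ (g @: U) U is ReflectT gU then restr gU else 1.

Lemma restr_perm_vsetE (V : finType) (U : {set V}) (g : {perm V})
    (gU : g @: U = U) (u : vset U) :
  val (restr_perm_vset V U g u) = g (val u).
Proof. by rewrite /restr_perm_vset; case: eqP => // gU'; rewrite permE. Qed.

(** Turns an identity of restrictions into a pointwise check on [U]; serves both multiplicativity
    and surjectivity. *)
Lemma restr_perm_vset_uniq (V : finType) (U : {set V}) (g : {perm V})
    (f : {perm vset U}) :
  g @: U = U -> extends g f -> restr_perm_vset V U g = f.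
Proof.
by move=> gU gf; apply/permP=> u; apply/val_inj; rewrite restr_perm_vsetE ?gf.
Qed.

Lemma restr_perm_vsetM (V : finType) (U : {set V}) (g h : {perm V}) :
  g @: U = U -> h @: U = U ->
  restr_perm_vset V U (g * h) = restr_perm_vset V U g * restr_perm_vset V U h.
Proof.
move=> gU hU; apply: restr_perm_vset_uniq => [|u].
  by rewrite (eq_imset _ (permM g h)) imset_comp gU hU.
by rewrite !permM !restr_perm_vsetE.
Qed.

Lemma restr_perm_vset_aut (V : finType) (G : sgraph V) (U : {set V})
    (G1 : sgraph (vset U)) (g : {perm V}) :
  faithful_representation G G1 -> g @: U = U -> g \in graph_aut G ->
  restr_perm_vset V U g \in graph_aut G1.
Proof.
by move=> [_ resG] gU gG; rewrite /restr_perm_vset; case: eqP => // gU'; apply: resG.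
Qed.

(* Restriction to [U] is the isomorphism: uniqueness of extensions makes it
   injective, and their existence makes it surjective. *)
Theorem theorem3p8 (V : finType) (G : sgraph V) (U W : {set V})
    (G1 : sgraph (vset U)) :
  bipartite G U W ->
  connected G ->
  irreducible G ->
  faithful_representation G G1 ->
  graph_aut G = aut_stab G U ->
  graph_aut G \isog graph_aut G1.
Proof.
move=> _ _ _ faithG stabG.
have stabU g : g \in graph_aut G -> g @: U = U.
  by rewrite stabG inE => /andP[_ /eqP].
have resM : {in graph_aut G &, {morph restr_perm_vset V U : g h / g * h}}.
  by move=> g h gG hG; rewrite restr_perm_vsetM ?stabU.
have resG g : g \in graph_aut G -> restr_perm_vset V U g \in graph_aut G1.
  by move=> gG; apply: restr_perm_vset_aut faithG (stabU g gG) gG.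
apply/isogP; exists (Morphism resM).
  apply/injmP=> g h gG hG /= eq_gh.
  (* Both [g] and [h] extend the restriction of [g], so each equals its unique extension [k]. *)
  have [k [_ uniq_k]] := faithG.1 _ (resG g gG).
  have <- : k = g.
    by apply: uniq_k; split=> // u; rewrite restr_perm_vsetE ?stabU.
  by apply: uniq_k; split=> // u; rewrite eq_gh restr_perm_vsetE ?stabU.
apply/eqP; rewrite morphimEdom eqEsubset; apply/andP; split.
  by apply/subsetP=> _ /imsetP[g gG ->]; apply: resG.
(* The preimage of [f] is its extension [g]. *)
apply/subsetP=> f fG1; have [g [[gG gf] _]] := faithG.1 f fG1.
by apply/imsetP; exists g; rewrite //= (restr_perm_vset_uniq _ _ _ _ _ gf) ?stabU.
Qed.
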